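(* Let $X$ be a non-negative random variable with log-concave tails and $\mathbb{P}(X>0)>0$. Let $N:[0,+\infty)\to[0,+\infty)$ be differentiable with $N(0)=0$ and such that its derivative $N'$ is convex and increasing. If $h>0$ is such that $$\int_0^h\mathbb{P}(X\geq t)\,dt\leq\frac12\mathbb{E}X,$$ then $$\mathbb{E}N(X)\geq\frac{\int_0^h\mathbb{P}(X\geq t)\,dt}{h}\,N\left(\frac{h}{\int_0^h\mathbb{P}(X\geq t)\,dt}\,\mathbb{E}X\right).$$
   Context: A random variable $X\geq0$ has log-concave tails if the function $T(t)=\mathbb{P}(X\geq t)$, $t\geq0$, is log-concave, i.e. $T((1-\tau)x+\tau y)\geq T(x)^{1-\tau}T(y)^{\tau}$ for all $x,y\geq0$, $\tau\in(0,1)$. ''Increasing'' means non-decreasing. At $0$ the derivative is the right derivative. $\mathbb{E}N(X)$ may equal $+\infty$. *)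

(* Defs.v *)
From HB Require Import structures.
From mathcomp Require Import all_boot all_order all_algebra.
From mathcomp Require Import all_classical all_reals all_analysis.

Set Implicit Arguments.
Unset Strict Implicit.
Unset Printing Implicit Defensive.

Import Order.TTheory GRing.Theory Num.Theory.
Import numFieldNormedType.Exports.

Local Open Scope classical_set_scope.
Local Open Scope ring_scope.

(* This is P (X >= t), with a closed half-line, whereas [ccdf X t] is the
   probability of the open event X > t. *)
Definition tail d (T : measurableType d) (R : realType) (P : probability T R)
    (X : T -> R) (t : R) : R :=
  fine (P [set w | t <= X w]).

(* [0 `^ a] is [0] for [a != 0], so the inequality is the usual one also where
   the tail vanishes. *)
Definition log_concave_tails d (T : measurableType d) (R : realType)
    (P : probability T R) (X : T -> R) : Prop :=
  forall x y tau : R, 0 <= x -> 0 <= y -> 0 < tau -> tau < 1 ->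
    tail P X x `^ (1 - tau) * tail P X y `^ tau
      <= tail P X ((1 - tau) * x + tau * y).

(* A function on [0, +oo[ is represented by a function on R whose values on the
   negative half-line are irrelevant; hence the one-sided derivative at 0. *)
Definition is_derivative_nneg (R : realType) (N N' : R -> R) : Prop :=
  (forall t : R, 0 < t -> is_derive t 1 N (N' t)) /\
  (s^-1 * (N s - N 0) @[s --> 0^'+] --> N' 0).

(* Main.v *)
Require Import Defs.
From HB Require Import structures.
From mathcomp Require Import all_boot all_order all_algebra.
From mathcomp Require Import all_classical all_reals all_analysis.
From mathcomp Require Import measurable_realfun ring lra.

(** Write m for the mean of X, I for the integral of the tail over [0, h],
    p = I / h and c = m / p. The claim reads p N(c) <= E N(X), with equality
    when X takes the value c with probability p and 0 otherwise. This suggests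
    bounding N from below, pointwise, by a function that touches N at 0 and is
    tangent to N at c, and whose expectation depends only on m and on
    E min(X, h). Among the functions A x - B min(x, h) the only candidate is
      L(x) = N'(c) x - K min(x, h),  with  K = (c N'(c) - N(c)) / h,
    the tangent line of N at c beyond the kink h, and a line through the origin
    before it ([kinked_minorant]).

    Beyond h, L <= N because N is convex. Before h, N is at least N'(0) x, so
    it suffices that the slope of that line is at most N'(0), that is,
      h (N'(c) - N'(0)) <= c N'(c) - N(c).
    As N' is convex, the trapezoid rule overestimates N(c), the integral of N'
    over [0, c], so the right-hand side is at least (c / 2) (N'(c) - N'(0))
    ([trapezoid_above]); and 2 h <= c is exactly the hypothesis I <= m / 2.

    Taking expectations, E N(X) >= N'(c) m - K E min(X, h). By the layer-cake
    formula E min(X, h) <= I ([expectation_min_le]) and K >= 0, so that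
    E N(X) >= N'(c) m - K I, which equals p N(c) since c I = m h. *)

Set Implicit Arguments.
Unset Strict Implicit.
Unset Printing Implicit Defensive.

Import Order.TTheory GRing.Theory Num.Theory.
Import numFieldNormedType.Exports.

Local Open Scope classical_set_scope.
Local Open Scope ring_scope.

(** * Primitives on the half-line of a convex nondecreasing function *)

Section one_sided_primitive.
Context {R : realType}.
Variables N N' : R -> R.
Hypothesis N_deriv : is_derivative_nneg N N'.

Lemma is_derivative_nneg_right_continuous0 : N s @[s --> 0^'+] --> N 0.
Proof.
have id0 : (s : R) @[s --> (0:R)^'+] --> (0 : R).
  by apply: cvg_at_right_filter; exact: cvg_id.
have : (s * (s^-1 * (N s - N 0)) + N 0) @[s --> 0^'+] --> 0 * N' 0 + N 0.
  by apply: cvgD; [exact: cvgM id0 N_deriv.2|exact: cvg_cst].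
rewrite mul0r add0r; apply: cvg_trans.
apply: near_eq_cvg; near=> s => /=.
have s0 : s != 0 by rewrite gt_eqF.
by rewrite mulrA divff// mul1r subrK.
Unshelve. all: by end_near. Qed.

Lemma is_derivative_nneg_continuous (t : R) : 0 < t -> {for t, continuous N}.
Proof.
move=> t0; apply: differentiable_continuous; apply/derivable1_diffP.
by have [] := N_deriv.1 t t0.
Qed.

Lemma is_derivative_nneg_within_continuous (a b : R) : 0 <= a -> a < b ->
  {within `[a, b], continuous N}.
Proof.
move=> a0 ab; apply/(continuous_within_itvP _ ab); split.
- move=> t; rewrite in_itv/= => /andP[at_ _].
  by apply: is_derivative_nneg_continuous; exact: le_lt_trans at_.
- move: a0; rewrite le_eqVlt => /predU1P[<-|a0].
    exact: is_derivative_nneg_right_continuous0.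
  by apply: cvg_at_right_filter; exact: is_derivative_nneg_continuous.
- apply: cvg_at_left_filter; apply: is_derivative_nneg_continuous.
  exact: le_lt_trans ab.
Qed.

Lemma is_derivative_nneg_MVT (a b : R) : 0 <= a -> a < b ->
  exists2 s, a < s < b & N b - N a = N' s * (b - a).
Proof.
move=> a0 ab; have dN t : t \in `]a, b[ -> is_derive t 1 N (N' t).
  rewrite in_itv/= => /andP[at_ _].
  by apply: N_deriv.1; exact: le_lt_trans at_.
have [s] := MVT ab dN (is_derivative_nneg_within_continuous a0 ab).
by rewrite in_itv/= => sab ->; exists s.
Qed.

(** The values of N on the negative half-line are arbitrary; composing with the
    absolute value makes it continuous on the whole line, and changes nothing
    for a nonnegative argument. *)
Lemma is_derivative_nneg_measurable : measurable_fun setT (fun t : R => N `|t|).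
Proof.
apply: continuous_measurable_fun => t.
have [->|t0] := eqVneq t 0.
  have N0 : forall e : R, 0 < e -> \forall s \near (0:R)^'+, `|N 0 - N s| < e.
    move=> e e0; have /cvgrPdist_lt := is_derivative_nneg_right_continuous0.
    exact.
  apply/cvgrPdist_lt => e e0; rewrite normr0.
  have [d /= d0 Hd] := N0 e e0.
  exists d => //= s; rewrite /ball_/= sub0r normrN => sd.
  have [->|s0] := eqVneq s 0; first by rewrite normr0 subrr normr0.
  by apply: Hd; rewrite ?normr_gt0//= sub0r normrN normr_id.
apply: (@continuous_comp _ _ _ (fun t : R => `|t|) N); first exact: norm_continuous.
by apply: is_derivative_nneg_continuous; rewrite normr_gt0.
Qed.

Hypothesis N'_incr : {in `[0, +oo[ &, {homo N' : s t / s <= t}}.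

Lemma tangent_below (x c : R) : 0 <= x -> 0 <= c ->
  N c + N' c * (x - c) <= N x.
Proof.
move=> x0 c0; have [xc|cx|->] := ltgtP x c; last by rewrite subrr mulr0 addr0.
- have [s /andP[xs sc] Ncx] := is_derivative_nneg_MVT x0 xc.
  have : N' s <= N' c.
    have s0 : 0 <= s by exact: le_trans (ltW xs).
    by apply: N'_incr; rewrite ?in_itv/= ?andbT// ltW.
  by nra.
- have [s /andP[cs sx] Nxc] := is_derivative_nneg_MVT c0 cx.
  have : N' c <= N' s.
    have s0 : 0 <= s by exact: le_trans (ltW cs).
    by apply: N'_incr; rewrite ?in_itv/= ?andbT// ltW.
  by nra.
Qed.

Lemma derivative0_ge0 : (forall t, 0 <= t -> 0 <= N t) -> N 0 = 0 -> 0 <= N' 0.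
Proof.
move=> N_ge0 N0; apply: (cvgr_to_ge N_deriv.2); near=> s.
by rewrite N0 subr0 mulr_ge0 ?invr_ge0 ?N_ge0// ltW.
Unshelve. all: by end_near. Qed.

Hypothesis N'_convex : convex_function (`[0, +oo[%classic : set R) N'.

Lemma derivative_below_chord (t c : R) : 0 < c -> 0 <= t -> t <= c ->
  N' t <= N' 0 + (N' c - N' 0) / c * t.
Proof.
move=> c0 t0 tc.
have p0 : 0 <= t / c by rewrite divr_ge0// ltW.
have p1 : t / c <= 1 by rewrite ler_pdivrMr// mul1r.
have : N' (t / c * c + (1 - t / c) * 0) <= t / c * N' c + (1 - t / c) * N' 0.
  by apply: (@N'_convex (Itv01 p0 p1) c 0); rewrite inE/= in_itv/= andbT// ltW.
rewrite mulr0 addr0 divfK ?gt_eqF// => /le_trans; apply.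
by rewrite le_eqVlt; apply/orP; left; apply/eqP; ring.
Qed.

(** The primitive of the chord of N' over [0, c] is the quadratic polynomial
    N'(0) t + k t^2 / 2, where k is the slope of that chord. Minus N, it is
    nondecreasing on [0, c], as its derivative is the gap between the chord
    and N'. *)
Lemma trapezoid_above (c : R) : 0 < c ->
  N c - N 0 <= c * (N' 0 + N' c) / 2.
Proof.
move=> c0.
set k := (N' c - N' 0) / c.
pose f t := N' 0 * t + k / 2 * t ^+ 2 - N t.
pose f' t := N' 0 + k * t - N' t.
have fd (t : R) : t \in `]0, c[ -> is_derive t 1 f (f' t).
  rewrite in_itv/= => /andP[t0 _]; have Nt := N_deriv.1 t t0.
  rewrite /f /f'; apply: is_derive_eq.
  by rewrite /GRing.scale/=; field.
have fc : {within `[0, c], continuous f}.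
  have qc : continuous (fun t : R => N' 0 * t + k / 2 * t ^+ 2).
    move=> t; apply: cvgD; apply: cvgM;
      [exact: cvg_cst|exact: cvg_id|exact: cvg_cst|exact: exprn_continuous].
  move=> t; apply: cvgB; first exact: (continuous_subspaceT qc).
  exact: (is_derivative_nneg_within_continuous (lexx 0) c0).
have [s + fE] := MVT c0 fd fc.
rewrite in_itv/= => /andP[s0 sc].
have f's : 0 <= f' s.
  by rewrite subr_ge0 derivative_below_chord// ltW.
have : 0 <= f c - f 0 by rewrite fE subr0 mulr_ge0// ltW.
have kc : k * c = N' c - N' 0 by rewrite /k divfK// gt_eqF.
rewrite /f expr0n /= !mulr0 addr0 add0r opprK expr2 => H.
have : k / 2 * (c * c) = (N' c - N' 0) * c / 2 by rewrite -kc; field.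
lra.
Qed.

(** The minorant of N whose expectation involves X only through its mean and
    its mean truncated at h. The coefficient of [Num.min x h] is forced by
    tangency at c; the condition [2 * h <= c] keeps the part before the kink
    below the tangent of N at 0. *)
Lemma kinked_minorant (x c h : R) : N 0 = 0 ->
  0 < h -> 2 * h <= c -> 0 <= x ->
  N' c * x <= N x + (c * N' c - N c) / h * Num.min x h.
Proof.
move=> N0 h0 hc x0.
have c0 : 0 < c by lra.
have [hx|xh] := leP h x.
  (* Past the kink the minorant is the tangent line at c. *)
  by rewrite divfK ?gt_eqF//; have := tangent_below x0 (ltW c0); lra.
have slope : h * (N' c - N' 0) <= c * N' c - N c.
  have := trapezoid_above c0; rewrite N0.
  have : N' 0 <= N' c by apply: N'_incr; rewrite ?in_itv/= ?andbT// ltW.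
  by nra.
have Nx : N' 0 * x <= N x.
  by have := tangent_below x0 (lexx 0); rewrite N0 subr0 add0r.
have : N' c - N' 0 <= (c * N' c - N c) / h by rewrite ler_pdivlMr// mulrC.
by nra.
Qed.

End one_sided_primitive.

(** * Truncated expectation and integrated tail *)

Section truncated_expectation.
Context d (T : measurableType d) (R : realType) (P : probability T R).
Variable X : {RV P >-> R}.

Let mu := @lebesgue_measure R.

Lemma tail_ge0 (t : R) : 0 <= tail P X t.
Proof. by rewrite /tail fine_ge0. Qed.

Lemma measurable_superlevel (t : R) : measurable [set w | t <= X w].
Proof.
rewrite (_ : [set w | _] = X @^-1` `[t, +oo[%classic).
  exact: measurable_funPTI.
by apply/seteqP; split => w /=; rewrite in_itv/= andbT.
Qed.

Lemma tailE (t : R) : (tail P X t)%:E = P [set w | t <= X w].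
Proof. by rewrite /tail fineK// fin_num_measure//; exact: measurable_superlevel. Qed.

Lemma tail_le1 (t : R) : tail P X t <= 1.
Proof. by rewrite -lee_fin tailE probability_le1//; exact: measurable_superlevel. Qed.

Lemma tail_nonincreasing : nonincreasing_fun (tail P X).
Proof.
move=> s t st; rewrite -lee_fin !tailE le_measure ?inE//;
  [exact: measurable_superlevel..|].
by move=> w /=; exact: le_trans.
Qed.

(** The integral is finite since the tail is at most 1, so the real-valued
    integral loses nothing. *)
Lemma integral_tail (h : R) : 0 <= h ->
  (\int[mu]_(t in `[0, h]) tail P X t)%:E
  = (\int[mu]_(t in `[0%R, h]) (tail P X t)%:E)%E.
Proof.
move=> h0; rewrite /Rintegral fineK// ge0_fin_numE; last first.
  by apply: integral_ge0 => t _; rewrite lee_fin tail_ge0.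
apply: (@le_lt_trans _ _ (\int[mu]_(t in `[0%R, h]) (cst 1%E t))%E).
  apply: ge0_le_integral => //.
  - by move=> t _; rewrite lee_fin tail_ge0.
  - apply/measurable_EFinP; apply: nonincreasing_measurable => //.
    exact: tail_nonincreasing.
  - by move=> t _; rewrite lee_fin tail_le1.
by rewrite integral_cst//= mul1e lebesgue_measure_itv/=; case: ifP; rewrite ?ltry.
Qed.

(** The layer-cake formula expresses the left-hand side by the probabilities of
    the open events t < X for t < h, which are at most those of the closed
    events t <= X. *)
Lemma expectation_min_le (h : R) : (forall w, 0 <= X w) -> 0 <= h ->
  ('E_P[fun w => Num.min (X w) h]
   <= (\int[mu]_(t in `[0, h]) tail P X t)%:E)%E.
Proof.
move=> X_ge0 h0; pose Y : {RV P >-> R} := (X \min cst h : {mfun T >-> R}).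
rewrite -[X in ('E_P[X] <= _)%E]/(Y : T -> R) integral_tail//.
rewrite ge0_expectation_ccdf; last first.
  by move=> w /=; rewrite le_min X_ge0.
have ccdfY0 (t : R) : h <= t -> ccdf Y t = 0%E.
  move=> ht; rewrite /ccdf /distribution /pushforward.
  rewrite (_ : _ @^-1` _ = set0) ?measure0//.
  apply/seteqP; split => w //=; rewrite in_itv/= andbT lt_min.
  by move=> /andP[_ /lt_le_trans/(_ ht)]; rewrite ltxx.
have ccdfY_le (t : R) : (ccdf Y t <= (tail P X t)%:E)%E.
  rewrite tailE /ccdf /distribution /pushforward le_measure ?inE//.
  - exact: measurable_funPTI.
  - exact: measurable_superlevel.
  - by move=> w /=; rewrite in_itv/= andbT lt_min => /andP[/ltW].
rewrite integral_mkcond [leRHS]integral_mkcond.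
apply: ge0_le_integral => //.
- by move=> t _; rewrite erestrict_ge0.
- apply/(measurable_restrictT _ _).1 => //.
  by apply: measurable_funS (ccdf_measurable Y).
- apply/(measurable_restrictT _ _).1 => //; apply/measurable_EFinP.
  by apply: nonincreasing_measurable => //; exact: tail_nonincreasing.
- move=> t _; rewrite /patch; case: ifPn => [|_]; last first.
    by case: ifP => //; rewrite lee_fin tail_ge0.
  rewrite inE/= in_itv/= andbT => t0; case: ifPn => // th.
  rewrite ccdfY0// ltW// ltNge; apply/negP => th'; move/negP: th; apply.
  by rewrite inE/= in_itv/= t0.
Qed.

End truncated_expectation.

(* The expectation of X is always finite under these hypotheses (a log-concave
   tail of a real random variable decays exponentially), so [fine 'E_P[X]] is
   the true expectation; 'E_P[N \o X] is extended-real and may be +oo. *)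
Theorem corollary1p5 (R : realType) (d : measure_display)
    (T : measurableType d) (P : probability T R) (X : {RV P >-> R})
    (N N' : R -> R) (h : R)
    (X_ge0 : forall w : T, 0 <= X w)
    (X_logconcave : log_concave_tails P X)
    (X_gt0 : (0 < P [set w | (0 < X w)%R])%E)
    (N_ge0 : forall t : R, 0 <= t -> 0 <= N t)
    (N_0 : N 0 = 0)
    (N_deriv : is_derivative_nneg N N')
    (N'_convex : convex_function (`[0, +oo[%classic : set R) N')
    (N'_incr : {in `[0, +oo[ &, {homo N' : s t / s <= t}})
    (h_gt0 : 0 < h)
    (h_half : ((\int[lebesgue_measure]_(t in `[0, h]) tail P X t)%:E
               <= (2^-1 : R)%:E * 'E_P[X])%E) :
  let I := \int[lebesgue_measure]_(t in `[0, h]) tail P X t in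
  ((I / h * N (h / I * fine 'E_P[X]))%:E <= 'E_P[N \o X])%E.
Proof.
set I := Rintegral _ _ _; cbv zeta.
have I0 : 0 <= I by apply: Rintegral_ge0 => t _; exact: tail_ge0.
have EN_ge0 : (0 <= 'E_P[N \o X])%E.
  by apply: expectation_ge0 => w /=; rewrite N_ge0.
have EX_ge0 : (0 <= 'E_P[X])%E by exact: expectation_ge0.
(* If I = 0 then I / h = 0, and [fine] sends an infinite mean to 0, so that the
   bound is a multiple of N 0: in both cases it remains that 0 <= E N(X). *)
have [I_eq0|I_neq0] := eqVneq I 0; first by rewrite I_eq0 !mul0r.
have I_gt0 : 0 < I by rewrite lt_neqAle eq_sym I_neq0.
have [EXoo|EX_neqoo] := eqVneq ('E_P[X])%E +oo%E.
  by rewrite EXoo /= mulr0 N_0 mulr0.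
have EXfin : ('E_P[X])%E \is a fin_num by rewrite ge0_fin_numE// ltey.
move: h_half; rewrite -/I -(fineK EXfin) -EFinM lee_fin.
set m := fine _ => Im.
set c := h / I * m.
have hc : 2 * h <= c.
  rewrite /c mulrAC ler_pdivlMr//; nra.
set A := N' c; set K := (c * A - N c) / h.
have c0 : 0 < c by lra.
have A0 : 0 <= A.
  apply: le_trans (derivative0_ge0 N_deriv N_ge0 N_0) _.
  by apply: N'_incr; rewrite ?in_itv/= ?andbT// ltW.
have K0 : 0 <= K.
  rewrite divr_ge0 ?(ltW h_gt0)// subr_ge0.
  have := tangent_below N_deriv N'_incr (lexx 0) (ltW c0).
  by rewrite N_0 -/A; lra.
have mN : measurable_fun setT (N \o X).
  rewrite (_ : N \o X = (fun t => N `|t|) \o X).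
    by apply: measurableT_comp => //; exact: is_derivative_nneg_measurable N_deriv.
  by apply/funext => w /=; rewrite ger0_norm.
have mmin : measurable_fun setT (fun w => Num.min (X w) h).
  exact: (measurable_minr (measurable_funPT X) (measurable_cst h)).
have min_ge0 w : 0 <= Num.min (X w) h by rewrite le_min X_ge0 ltW.
(* The subtracted term of the minorant is moved to the other side, so that only
   nonnegative functions are integrated and E N(X) may be infinite. *)
have main : (A%:E * 'E_P[X] <= 'E_P[N \o X] + K%:E * I%:E)%E.
  apply: (@le_trans _ _ ('E_P[N \o X] + K%:E * 'E_P[fun w => Num.min (X w) h])%E).
    rewrite unlock -!ge0_integralZl_EFin//; first last.
    - exact/measurable_EFinP.
    - by move=> w _; rewrite lee_fin.
    - exact/measurable_EFinP.
    - by move=> w _; rewrite lee_fin.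
    rewrite -ge0_integralD//; first last.
    - by apply/measurable_EFinP; apply: measurable_funM.
    - by move=> w _; rewrite lee_fin mulr_ge0.
    - exact/measurable_EFinP.
    - by move=> w _; rewrite lee_fin N_ge0.
    apply: ge0_le_integral => //.
    - by move=> w _; rewrite lee_fin mulr_ge0.
    - by apply/measurable_EFinP; apply: measurable_funM.
    - apply/measurable_EFinP; apply: measurable_funD => //.
      exact: measurable_funM.
    - move=> w _; rewrite lee_fin.
      exact: (kinked_minorant N_deriv N'_incr N'_convex).
  by rewrite leeD2l// lee_wpmul2l ?lee_fin//; exact/expectation_min_le/ltW.
have IcE : c * I / h = m by rewrite /c; field; rewrite I_neq0 gt_eqF.
rewrite -[leLHS](_ : (A * m - K * I)%:E = _)%E.
  by rewrite EFinB leeBlDr// EFinM /m fineK.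
by rewrite -IcE /K; congr EFin; field; rewrite gt_eqF.
Qed.
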